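(* Let $n \ge 1$ and $r \ge 1$ be integers. (a) Let $A$ be an $n \times n$ real Hankel matrix, all of whose contiguous minors of size $\le r$ are nonnegative. Then $A$ is TN$_r$. (b) Let $A$ and $B$ be $n \times n$ real Hankel matrices, all of whose contiguous minors of size $\le r$ are nonnegative. Then $A+B$ is TN$_r$. (c) Let $A$ (resp. $B$) be an $n \times n$ real Hankel matrix, all of whose contiguous minors of size $\le r$ are nonnegative (resp. positive). Then $A+B$ is TP$_r$.
   Context: All matrices have real entries. A square matrix $A=(a_{ij})_{1\le i,j\le n}$ is Hankel if $a_{ij}$ depends only on $i+j$, i.e. $a_{ij}=a_{i'j'}$ whenever $i+j=i'+j'$. A minor is the determinant of a square submatrix $A_{IJ}$ (rows $I$, columns $J$, $|I|=|J|$, kept in their original order); its size is $|I|$. A submatrix $A_{IJ}$ and the corresponding minor $\det A_{IJ}$ are called contiguous if $|I|=|J|$ and both $I$ and $J$ are sets of consecutive integers. A matrix is TN$_r$ (totally nonnegative of order $r$) if every minor of size $\le r$ is nonnegative, and TP$_r$ (totally positive of order $r$) if every minor of size $\le r$ is positive. *)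

(* Defs.v *)
From mathcomp Require Import all_boot all_order all_algebra.
From mathcomp Require Import reals.

Set Implicit Arguments.
Unset Strict Implicit.
Unset Printing Implicit Defensive.

Import Order.TTheory GRing.Theory Num.Theory.
Local Open Scope ring_scope.

Definition hankel (R : Type) (n : nat) (A : 'M[R]_n) : Prop :=
  forall i j i' j' : 'I_n, (i + j = i' + j')%N -> A i j = A i' j'.

(* A set I of k indices, listed in its original order, is represented by the
   strictly increasing map 'I_k -> 'I_n with image I; if f and g represent I and
   J, then mxsub f g A is the submatrix A_{IJ}. *)
Definition increasing (k n : nat) (f : 'I_k -> 'I_n) : Prop :=
  {homo f : i j / (i < j)%N}.

Definition consecutive (k n : nat) (f : 'I_k -> 'I_n) : Prop :=
  exists a : nat, forall i : 'I_k, f i = (a + i)%N :> nat.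

(* Below, k ranges over the sizes of the minors. The case k = 0 is harmless:
   the empty determinant is 1. *)
Definition TN (R : realType) (n r : nat) (A : 'M[R]_n) : Prop :=
  forall (k : nat) (f g : 'I_k -> 'I_n), (k <= r)%N ->
    increasing f -> increasing g -> 0 <= \det (mxsub f g A).

Definition TP (R : realType) (n r : nat) (A : 'M[R]_n) : Prop :=
  forall (k : nat) (f g : 'I_k -> 'I_n), (k <= r)%N ->
    increasing f -> increasing g -> 0 < \det (mxsub f g A).

Definition contiguous_minors_ge0 (R : realType) (n r : nat) (A : 'M[R]_n) : Prop :=
  forall (k : nat) (f g : 'I_k -> 'I_n), (k <= r)%N ->
    consecutive f -> consecutive g -> 0 <= \det (mxsub f g A).

Definition contiguous_minors_gt0 (R : realType) (n r : nat) (A : 'M[R]_n) : Prop :=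
  forall (k : nat) (f g : 'I_k -> 'I_n), (k <= r)%N ->
    consecutive f -> consecutive g -> 0 < \det (mxsub f g A).

(* Main.v *)
(** Let [L] be the linear functional with [L(X^m) = h m], where [h] is the sequence
    of antidiagonal entries.  The contiguous block of size [k] starting at the
    antidiagonal [a] is the Gram matrix of the form [L(X^a p q)] in degrees [< k].

    Nonnegativity of the contiguous minors makes these forms positive semidefinite,
    by induction on [k].  If the block of size [k - 1] is nonsingular, orthogonalise.
    Otherwise the minors force a kernel element of the block of size [k], and the
    semidefiniteness of the smaller blocks at [a + 1] and [a + 2] lets one multiply
    it by [X] until its degree is exactly [k - 2].

    Semidefiniteness is additive, and adding a definite form gives positive
    contiguous minors.  Fekete's argument, an induction on the gaps in the index sets
    based on a three-term Pluecker relation, then gives all minors of size [<= r].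
    The nonnegative case follows by perturbing with the definite moments
    [\sum_t (t + 1)^m]. *)

Require Import Defs.
From HB Require Import structures.
From mathcomp Require Import all_boot all_order all_algebra.
From mathcomp Require Import perm reals.
From mathcomp Require Import zify ring lra.

Set Implicit Arguments.
Unset Strict Implicit.
Unset Printing Implicit Defensive.

Import Order.TTheory GRing.Theory Num.Theory.
Local Open Scope ring_scope.

(** * Determinants of index functions *)

(* Matrix entries are indexed by [nat], so that minors are obtained by composing the
   index functions, with no casts between ordinal types. *)
Definition fdet (R : comNzRingType) (n : nat) (F : nat -> nat -> R) : R :=
  \det (\matrix_(i < n, j < n) F i j).

Lemma eq_fdet (R : comNzRingType) (n : nat) (F G : nat -> nat -> R) :
  (forall i j, (i < n)%N -> (j < n)%N -> F i j = G i j) -> fdet n F = fdet n G.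
Proof.
move=> eFG; rewrite /fdet; congr (\det _); apply/matrixP => i j.
by rewrite !mxE eFG.
Qed.

Lemma fdet_tr (R : comNzRingType) (n : nat) (F : nat -> nat -> R) :
  fdet n (fun i j => F j i) = fdet n F.
Proof.
rewrite /fdet -det_tr; congr (\det _); apply/matrixP => i j; by rewrite !mxE.
Qed.

Lemma fdet0 (R : comNzRingType) (F : nat -> nat -> R) : fdet 0 F = 1.
Proof. exact: det_mx00. Qed.

Lemma fdet_last_row (R : comNzRingType) (n : nat) (F : nat -> nat -> R) :
  (forall j, (j < n)%N -> F n j = 0) -> fdet n.+1 F = F n n * fdet n F.
Proof.
move=> F0; rewrite /fdet (expand_det_row _ ord_max) big_ord_recr /= big1 => [|i _].
  rewrite add0r mxE /cofactor /= exprD -expr2 sqrr_sign mul1r; congr (_ * \det _).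
  by apply/matrixP => i j; rewrite !mxE !lift_max.
by rewrite mxE /= F0 // mul0r.
Qed.

Lemma fdet_last_col (R : comNzRingType) (n : nat) (F : nat -> nat -> R) :
  (forall i, (i < n)%N -> F i n = 0) -> fdet n.+1 F = F n n * fdet n F.
Proof. by move=> F0; rewrite -fdet_tr fdet_last_row // fdet_tr. Qed.

Lemma fdet_swap_last (R : comNzRingType) (n : nat) (F : nat -> nat -> R) :
  let sw i := if i == n then n.+1 else if i == n.+1 then n else i in
  fdet n.+2 (fun i j => F (sw i) j) = - fdet n.+2 F.
Proof.
move=> sw; pose i1 : 'I_n.+2 := Ordinal (leqnSn n.+1).
rewrite /fdet -[RHS]mulN1r.
transitivity (\det (xrow i1 ord_max (\matrix_(i < n.+2, j < n.+2) F i j))).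
  congr (\det _); apply/matrixP => i j; rewrite !mxE; congr F.
  rewrite /sw; case: tpermP => [->|->|/eqP ne1 /eqP ne2] /=; rewrite ?eqxx //.
    by rewrite eqn_leq ltnn.
  by rewrite !ifN.
by rewrite xrowE det_mulmx /tperm_mx det_perm odd_tperm -val_eqE /= ltn_eqF // expr1.
Qed.

(** Laplace expansion along the last column; [bump s] skips the row [s]. *)
Lemma fdet_delta_col (R : comNzRingType) (n s : nat) (M : nat -> nat -> R) :
  (s <= n)%N ->
  fdet n.+1 (fun i j => if (j < n)%N then M i j else (i == s)%:R)
  = (-1) ^+ (s + n) * fdet n (fun i j => M (bump s i) j).
Proof.
move=> le_sn; rewrite /fdet (expand_det_col _ ord_max).
rewrite (bigD1 (Ordinal (le_sn : s < n.+1)%N)) //= big1 => [|i ne_is].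
  rewrite addr0 mxE /= ltnn eqxx mul1r /cofactor /=; congr (_ * \det _).
  by apply/matrixP => i j; rewrite !mxE !lift_max ltn_ord /=.
rewrite mxE /= ltnn; suff /negPf -> : nat_of_ord i != s by rewrite mul0r.
by apply: contra ne_is => /eqP e; apply/eqP/val_inj.
Qed.

(** * A three-term Pluecker relation *)

Section Pluecker.
Variables (R : comNzRingType) (k : nat) (M : nat -> nat -> R).

Definition colmx2 (x y : nat -> R) : 'M[R]_k.+2 :=
  \matrix_(i, j) (if (j < k)%N then M i j else if j == k :> nat then x i else y i).

(** Linearity in the last column: the [u i] are its cofactors, which do not see [y]. *)
Lemma det_colmx2E (x : nat -> R) :
  exists u : 'I_k.+2 -> R, forall y, \det (colmx2 x y) = \sum_(i < k.+2) y i * u i.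
Proof.
exists (fun i => cofactor (colmx2 x (fun=> 0)) i ord_max) => y.
rewrite (expand_det_col _ ord_max); apply: eq_bigr => i _; congr (_ * _).
  by rewrite mxE /= ltnNge leqnSn /= eqn_leq ltnn.
rewrite /cofactor; congr (_ * \det _); apply/matrixP => i' j; rewrite !mxE lift_max.
case: ltnP => // le_kj.
have -> : nat_of_ord j = k by apply: anti_leq; rewrite le_kj -ltnS ltn_ord.
by rewrite eqxx.
Qed.

Lemma det_colmx2_col (x : nat -> R) (j : nat) :
  (j < k)%N -> \det (colmx2 x (M^~ j)) = 0.
Proof.
move=> lt_jk; rewrite -det_tr.
have lt_jk2 : (j < k.+2)%N by lia.
apply: (determinant_alternate (i1 := Ordinal lt_jk2) (i2 := ord_max)).
  by rewrite -val_eqE /=; lia.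
move=> i; rewrite !mxE /= lt_jk ltnNge leqnSn /=.
by have -> : (k.+1 == k) = false by lia.
Qed.

(** Cramer's rule for [colmx2 c d] with right-hand side [b], with denominators cleared by the
    adjugate so that singular matrices are covered. The last two coordinates are the determinants
    with [b] in place of [c] or [d]. *)
Lemma cramer_colmx2 (b c d : nat -> R) :
  exists z : 'I_k -> R, forall i : 'I_k.+2,
  \det (colmx2 c d) * b i =
    (\sum_(j < k) M i j * z j) + c i * \det (colmx2 b d) + d i * \det (colmx2 c b).
Proof.
pose N := colmx2 c d; pose w := \adj N *m (\col_i b i).
exists (fun j => w (widen_ord (leqnSn _) (widen_ord (leqnSn _) j)) 0) => i.
have /matrixP /(_ i 0) : N *m w = \det N *: (\col_i b i).
  by rewrite mulmxA mul_mx_adj mul_scalar_mx.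
rewrite [X in _ = X -> _]mxE [X in _ = _ * X -> _]mxE => <-.
rewrite mxE 2!big_ord_recr /=; congr (_ + _ + _).
- by apply: eq_bigr => j _; rewrite mxE /= ltn_ord.
- rewrite mxE /= ltnn eqxx; congr (_ * _).
  rewrite mxE (expand_det_col _ (widen_ord (leqnSn _) ord_max)); apply: eq_bigr => i' _.
  rewrite !mxE /= ltnn eqxx mulrC /cofactor; congr (_ * (_ * \det _)).
  apply/matrixP => s t; rewrite !mxE /= /bump.
  case: (leqP k t) => le_kt; last by rewrite add0n le_kt.
  rewrite add1n ltnNge (leqW le_kt) /=.
  by rewrite gtn_eqF ?ltnS.
- rewrite mxE /= ltnNge leqnSn /= eqn_leq ltnn /=; congr (_ * _).
  rewrite mxE (expand_det_col _ ord_max); apply: eq_bigr => i' _.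
  rewrite !mxE /= ltnNge leqnSn /= eqn_leq ltnn /= mulrC /cofactor; congr (_ * (_ * \det _)).
  apply/matrixP => s t; rewrite !mxE.
  have -> : lift ord_max t = t :> nat by exact: lift_max.
  case: ltnP => // le_kt.
  have -> : nat_of_ord t = k by apply: anti_leq; rewrite le_kt -ltnS ltn_ord.
  by rewrite eqxx.
Qed.

(** Apply the linear map [y |-> \det (colmx2 M a y)] to the identity of [cramer_colmx2]; it kills
    the columns of [M]. *)
Lemma pluecker (a b c d : nat -> R) :
  \det (colmx2 c d) * \det (colmx2 a b) =
  \det (colmx2 b d) * \det (colmx2 a c) + \det (colmx2 c b) * \det (colmx2 a d).
Proof.
have [u uE] := det_colmx2E a; have [z zE] := cramer_colmx2 b c d.
rewrite (uE b) mulr_sumr; under eq_bigr do rewrite mulrA zE !mulrDl.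
rewrite !big_split /= -!addrA [X in X + _](_ : _ = 0) ?add0r.
  rewrite (uE c) (uE d) !mulr_sumr.
  by congr (_ + _); apply: eq_bigr => i _; ring.
under eq_bigr do rewrite mulr_suml.
rewrite exchange_big big1 //= => j _.
under eq_bigr do rewrite mulrAC.
by rewrite -mulr_suml -(uE (M^~ j)) det_colmx2_col // mul0r.
Qed.

End Pluecker.

(* The Pluecker relation for the last column of [M] and the unit vectors [e_s], [e_0]
   and [e_(k+1)]: a unit vector [e_i] in a determinant removes row [i]. *)
Lemma three_term (R : comNzRingType) (k s : nat) (M : nat -> nat -> R) :
  (0 < s <= k)%N ->
  fdet k.+1 (fun i => M (bump s i)) * fdet k (fun i => M i.+1) =
  fdet k.+1 (fun i => M i.+1) * fdet k (fun i => M (bump s i)) +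
  fdet k.+1 M * fdet k (fun i => M (bump s i.+1)).
Proof.
move=> /andP[s0 sk]; pose e (t i : nat) : R := (i == t)%:R.
have e1 t : (t <= k.+1)%N -> \det (colmx2 k M (M^~ k) (e t)) =
    (-1) ^+ (t + k.+1) * fdet k.+1 (fun i => M (bump t i)).
  move=> le_tk; rewrite -fdet_delta_col //; congr (\det _).
  apply/matrixP => i j; rewrite !mxE ltnS.
  by case: (ltngtP j k) => // ->.
have e2 t t' : (t < t' <= k.+1)%N -> \det (colmx2 k M (e t) (e t')) =
    (-1) ^+ (t + t').+1 * fdet k (fun i => M (bump t' (bump t i))).
  move=> /andP[lt_tt' le_tk].
  have := @fdet_delta_col R k.+1 t'
    (fun i j => if (j < k)%N then M i j else (i == t)%:R) le_tk.
  rewrite (_ : fdet _ _ = \det (colmx2 k M (e t) (e t'))); last first.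
    congr (\det _); apply/matrixP => i j; rewrite !mxE ltnS.
    by case: (ltngtP j k).
  move=> ->.
  (* As [t < t'], deleting row [t'] leaves the unit vector [e t] in place. *)
  rewrite (@eq_fdet _ _ _ (fun i j => if (j < k)%N then M (bump t' i) j else (i == t)%:R)).
    rewrite (@fdet_delta_col R k t (fun i => M (bump t' i))); last by lia.
    rewrite mulrA -exprD; congr (_ * _).
    have -> : (t' + k.+1 + (t + k) = (t + t').+1 + (k + k))%N by lia.
    by rewrite exprD -(signr_odd _ (k + k)) oddD addbb expr0 mulr1.
  move=> i j _ _; case: ifP => // _; congr (_%:R).
  by congr nat_of_bool; rewrite /bump; lia.
have := pluecker k M (M^~ k) (e s) (e 0%N) (e k.+1).
rewrite !e1 ?e2; try lia.
have eM n (n1 : (n <= k.+1)%N) : fdet n (fun i => M (bump k.+1 i)) = fdet n M.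
  by apply: eq_fdet => i j lti _; rewrite /bump leqNgt (leq_trans lti n1).
have eM' n t (n1 : (n <= k)%N) : fdet n (fun i => M (bump k.+1 (bump t i)))
    = fdet n (fun i => M (bump t i)).
  by apply: eq_fdet => i j lti _; congr (M _ _); rewrite /bump; lia.
rewrite !eM // !eM' // !add0n.
change (fun i => M (bump 0 i)) with (fun i => M i.+1).
change (fun i => M (bump s (bump 0 i))) with (fun i => M (bump s i.+1)).
rewrite !exprS !exprD exprS.
rewrite -[(-1) ^+ s]signr_odd -[(-1) ^+ k]signr_odd.
(* All three products carry the same sign [- (-1) ^+ s], which this factor cancels. *)
move=> /(congr1 (fun z => - (-1) ^+ odd s * z)).
case: (odd s); case: (odd k); rewrite ?expr1 ?expr0 => e3;
  by apply: etrans (etrans _ e3) _; ring.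
Qed.

(** * Fekete's criterion *)

Definition increasing_below (n k : nat) (f : nat -> nat) : Prop :=
  (forall i j, (i < j < k)%N -> (f i < f j)%N) /\
  (forall i, (i < k)%N -> (f i < n)%N).

Section Fekete.
Variable R : realDomainType.

(** The columns stay initial. Induction on the size, then on the span [f k - f 0]: a span without
    gaps is contiguous, and a gap is filled by one more index. *)
Lemma fekete_rows (n r : nat) (a : nat -> nat -> R) :
  (forall k b, (k <= r)%N -> (b + k <= n)%N -> 0 < fdet k (fun i => a (b + i)%N)) ->
  forall k f, (k <= r)%N -> increasing_below n k f -> 0 < fdet k (fun i => a (f i)).
Proof.
move=> a_gt0; elim=> [|k IHk] f le_kr; first by rewrite fdet0.
have [d] := ubnP (f k - f 0)%N; elim: d f => // d IHd f lt_fd [f_inc f_bnd].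
have [/existsP[t gap_t] | no_gap] := boolP [exists t : 'I_k, (f t).+1 < f t.+1]%N.
  have := ltn_ord t; move: (nat_of_ord t) gap_t => {}t gap_t lt_tk.
  (* [v] inserts into [f] the index [f t + 1] from the gap after position [t]. *)
  pose v i := if (i <= t)%N then f i else if i == t.+1 then (f t).+1 else f i.-1.
  have v_inc i j : (i < j <= k.+1)%N -> (v i < v j)%N.
    move=> /andP[lt_ij le_jk]; rewrite /v.
    have f_le i1 j1 : (i1 <= j1 <= k)%N -> (f i1 <= f j1)%N.
      case: (ltngtP i1 j1) => [lt1 /= le1| //|-> //].
      by apply/ltnW/f_inc; rewrite lt1.
    case: (leqP i t) => le_it; case: (leqP j t) => le_jt; try lia.
    - by apply: f_inc; lia.
    - case: eqP => ej; first by rewrite ltnS f_le //; lia.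
      by apply: f_inc; lia.
    - case: (eqVneq i t.+1) => ei; case: (eqVneq j t.+1) => ej; try lia.
        by apply: leq_trans gap_t _; apply: f_le; lia.
      by apply: f_inc; lia.
  have v_bnd i : (i <= k.+1)%N -> (v i < n)%N.
    move=> le_ik; rewrite /v; case: (leqP i t) => le_it; first by apply: f_bnd; lia.
    case: eqP => _; last by apply: f_bnd; lia.
    by apply: leq_trans gap_t _; apply/ltnW/f_bnd; lia.
  have v_comp m g : increasing_below k.+2 m g -> increasing_below n m (v \o g).
    move=> [g_inc g_bnd]; split=> [i j lt_ij|i lt_im] /=; last by apply/v_bnd/g_bnd.
    by apply: v_inc; rewrite g_inc //= -ltnS g_bnd; lia.
  have vf i : v (bump t.+1 i) = f i.
    rewrite /v /bump; case: (ltngtP t i) => // cmp_ti.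
    - by rewrite add1n ifF ?ifF //; lia.
    - by rewrite add0n (ltnW cmp_ti).
    - by rewrite add0n cmp_ti leqnn.
  have := @three_term R k t.+1 (fun i => a (v i)) lt_tk.
  rewrite (_ : fdet k.+1 _ = fdet k.+1 (fun i => a (f i))); last first.
    by apply: eq_fdet => i j _ _; rewrite vf.
  (* The size-[k] minors are positive by [IHk]. The two of size [k.+1] on the right omit the first
     or last index of [v], so their span is smaller and [IHd] applies. *)
  move=> e3; rewrite -(@pmulr_lgt0 _ (fdet k (fun i => a (v i.+1)))) ?e3.
    have vlast : v k.+1 = f k by rewrite /v ifF ?ifF //; lia.
    have v0 : v 0%N = f 0%N by [].
    have v01 : (v 0%N < v 1%N)%N by exact: v_inc.
    have v1k : (v 1%N < v k.+1)%N by apply: v_inc; lia.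
    have vk0 : (v 0%N < v k)%N by apply: v_inc; lia.
    have vkk : (v k < v k.+1)%N by apply: v_inc; lia.
    rewrite addr_gt0 // mulr_gt0 //.
    - apply: (IHd (v \o succn)) => /=.
        lia.
      by apply: v_comp; split=> [i j|i]; lia.
    - apply: (IHk (v \o bump t.+1)); first exact: ltnW.
      by apply: v_comp; split=> [i j|i]; rewrite /bump; lia.
    - apply: (IHd v) => /=; first lia.
      by apply: (v_comp _ id); split=> [i j|i]; lia.
    - apply: (IHk (v \o (bump t.+1 \o succn))); first exact: ltnW.
      by apply: v_comp; split=> [i j|i] /=; rewrite /bump; lia.
  apply: (IHk (v \o succn)); first exact: ltnW.
  by apply: v_comp; split=> [i j|i]; lia.
have f_cont i : (i <= k)%N -> f i = (f 0 + i)%N.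
  elim: i => [|i IHi] lt_ik; first by rewrite addn0.
  have fS : (f i < f i.+1)%N by apply: f_inc; lia.
  move: no_gap; rewrite negb_exists => /forallP/(_ (Ordinal lt_ik)) /= no_gap.
  have := IHi (ltnW lt_ik); lia.
rewrite (@eq_fdet _ _ _ (fun i => a (f 0 + i)%N)) => [|i j lt_ik _].
  by apply: a_gt0 => //; rewrite addnS -f_cont // f_bnd.
by rewrite f_cont.
Qed.

(** Two passes of [fekete_rows]: first on the transpose, where the columns are initial segments of
    [f], then on those segments with contiguous columns [c + j]. *)
Lemma fekete (n r : nat) (a : nat -> nat -> R) :
  (forall k b c, (k <= r)%N -> (b + k <= n)%N -> (c + k <= n)%N ->
     0 < fdet k (fun i j => a (b + i) (c + j))%N) ->
  forall k f g, (k <= r)%N -> increasing_below n k f -> increasing_below n k g ->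
  0 < fdet k (fun i j => a (f i) (g j)).
Proof.
move=> a_gt0 k f g le_kr fP gP; rewrite -fdet_tr.
apply: (@fekete_rows n k (fun i j => a (f j) i)) gP => // l c le_lk le_cl.
rewrite -fdet_tr /=.
have fPl : increasing_below n l f.
  by case: fP => f_inc f_bnd; split=> [i j ij|i il]; [apply: f_inc|apply: f_bnd]; lia.
apply: (@fekete_rows n l (fun i j => a i (c + j)%N)) fPl => // m b le_ml le_bm.
by apply: a_gt0; lia.
Qed.

End Fekete.

(** * Hankel forms on polynomials *)

Section HankelForm.
Variables (R : realType) (h : nat -> R).

Definition moment (p : {poly R}) : R := \sum_(i < size p) p`_i * h i.

Lemma moment_wide (n : nat) (p : {poly R}) :
  (size p <= n)%N -> moment p = \sum_(i < n) p`_i * h i.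
Proof.
move=> le_pn; rewrite /moment (big_ord_widen_cond n xpredT (fun i => p`_i * h i)) //.
rewrite big_mkcond; apply: eq_bigr => i _ /=; case: ltnP => // le_pi.
by rewrite nth_default ?mul0r.
Qed.

Lemma moment_is_scalar : scalar moment.
Proof.
move=> c p q; pose n := maxn (size p) (size q).
have le_pn : (size p <= n)%N by exact: leq_maxl.
have le_qn : (size q <= n)%N by exact: leq_maxr.
have le_n : (size (c *: p + q)%R <= n)%N.
  by rewrite (leq_trans (size_polyD _ _)) // geq_max le_qn (leq_trans (size_scale_leq _ _)).
rewrite !(@moment_wide n) // mulr_sumr -big_split; apply: eq_bigr => i _ /=.
by rewrite coefD coefZ mulrDl mulrA.
Qed.

HB.instance Definition _ := GRing.isLinear.Build R {poly R} R *%R moment moment_is_scalar.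

Lemma momentXn (n : nat) : moment 'X^n = h n.
Proof.
rewrite (@moment_wide n.+1) ?size_polyXn // big_ord_recr /= coefXn eqxx mul1r.
by rewrite big1 ?add0r // => i _; rewrite coefXn ltn_eqF ?mul0r.
Qed.

Definition hform (a : nat) (p q : {poly R}) : R := moment ('X^a * p * q).

Lemma hformC a p q : hform a p q = hform a q p.
Proof. by rewrite /hform mulrAC. Qed.

Lemma hformDr a p q1 q2 : hform a p (q1 + q2) = hform a p q1 + hform a p q2.
Proof. by rewrite /hform mulrDr linearD. Qed.

Lemma hformZr a p c q : hform a p (c *: q) = c * hform a p q.
Proof. by rewrite /hform -scalerAr linearZ. Qed.

Lemma hform0r a p : hform a p 0 = 0.
Proof. by rewrite /hform mulr0 linear0. Qed.

Lemma hform_sumr a p n (q : 'I_n -> {poly R}) :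
  hform a p (\sum_i q i) = \sum_i hform a p (q i).
Proof. by rewrite /hform mulr_sumr linear_sum. Qed.

Lemma hformDl a p1 p2 q : hform a (p1 + p2) q = hform a p1 q + hform a p2 q.
Proof. by rewrite hformC hformDr !(hformC _ q). Qed.

Lemma hformZl a c p q : hform a (c *: p) q = c * hform a p q.
Proof. by rewrite hformC hformZr hformC. Qed.

Lemma hformXn a i j : hform a 'X^i 'X^j = h (a + i + j)%N.
Proof. by rewrite /hform -!exprD momentXn. Qed.

Lemma hformMXr a p q : hform a p ('X * q) = hform a.+1 p q.
Proof. by rewrite /hform exprSr; congr moment; ring. Qed.

Lemma hformMXl a p q : hform a ('X * p) q = hform a.+1 p q.
Proof. by rewrite hformC hformMXr hformC. Qed.

Definition hminor (a k : nat) : R := fdet k (fun i j => h (a + i + j)%N).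

Definition hpsd (a k : nat) : Prop :=
  forall p : {poly R}, (size p <= k)%N -> 0 <= hform a p p.

Definition hpd (a k : nat) : Prop :=
  forall p : {poly R}, (size p <= k)%N -> p != 0 -> 0 < hform a p p.

Lemma poly_sumXn (k : nat) (p : {poly R}) : (size p <= k)%N -> p = \sum_(i < k) p`_i *: 'X^i.
Proof.
move=> le_pk; rewrite -poly_def; apply/polyP => i; rewrite coef_poly.
by case: ltnP => // le_ki; rewrite nth_default // (leq_trans le_pk).
Qed.

Lemma hform_orthP (a k : nat) (p : {poly R}) :
  (forall i, (i < k)%N -> hform a p 'X^i = 0) ->
  forall s : {poly R}, (size s <= k)%N -> hform a p s = 0.
Proof.
move=> p0 s /poly_sumXn ->; rewrite hform_sumr big1 // => i _.
by rewrite hformZr p0 ?mulr0.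
Qed.

(** The change of basis from the ['X^i] to the [q i] is unitriangular, hence of determinant 1. *)
Lemma hminor_gram (a k : nat) (q : nat -> {poly R}) :
  (forall i, (i < k)%N -> q i \is monic /\ size (q i) = i.+1) ->
  fdet k (fun i j => hform a (q i) (q j)) = hminor a k.
Proof.
move=> qP; pose Q : 'M[R]_k := \matrix_(i, j) (q i)`_j.
have detQ : \det Q = 1.
  rewrite det_trig; last first.
    apply/is_trig_mxP => i j lt_ij; rewrite mxE nth_default //.
    by have [_ ->] := qP i (ltn_ord i).
  rewrite big1 // => i _; rewrite mxE; have [/monicP q1 sq] := qP i (ltn_ord i).
  by rewrite -q1 lead_coefE sq.
rewrite /hminor /fdet -[RHS]mul1r -{1}detQ -[RHS]mulr1 -{1}detQ -[in X in _ = _ * X]det_tr.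
rewrite -!det_mulmx; congr (\det _); apply/matrixP => i j; rewrite !mxE.
have sz (l : 'I_k) : (size (q l) <= k)%N by have [_ ->] := qP l (ltn_ord l).
rewrite {1}(poly_sumXn (sz j)) hform_sumr; apply: eq_bigr => l _.
rewrite hformZr mulrC !mxE; congr (_ * _).
rewrite hformC {1}(poly_sumXn (sz i)) hform_sumr; apply: eq_bigr => m _.
by rewrite hformZr hformXn !mxE addnAC.
Qed.

Lemma hminor_eq0 (a k : nat) : hminor a k = 0 ->
  exists p : {poly R}, [/\ p != 0, (size p <= k)%N &
    forall s : {poly R}, (size s <= k)%N -> hform a p s = 0].
Proof.
move=> /eqP/det0P[v v_neq0 vH]; have sv : (size (rVpoly v) <= k)%N by exact: size_poly.
exists (rVpoly v); split=> //.
- apply: contra v_neq0 => /eqP v0; rewrite -[v]rVpolyK v0.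
  by apply/eqP/rowP => i; rewrite !mxE coef0.
apply: hform_orthP => i lt_ik; rewrite hformC (poly_sumXn sv) hform_sumr.
have /rowP/(_ (Ordinal lt_ik)) := vH; rewrite !mxE => vi.
rewrite -[RHS]vi; apply: eq_bigr => j _.
by rewrite hformZr hformXn !mxE coef_rVpoly_ord addnAC.
Qed.

(** The monic orthogonal polynomial of degree [k]: [v] holds the coordinates of the projection of
    ['X^k] onto lower degrees. *)
Lemma hminor_neq0 (a k : nat) : hminor a k != 0 ->
  exists q : {poly R}, [/\ q \is monic, size q = k.+1 &
    forall s : {poly R}, (size s <= k)%N -> hform a q s = 0].
Proof.
move=> d0; pose H : 'M[R]_k := \matrix_(i, j) h (a + i + j)%N.
have uH : H \in unitmx by rewrite unitmxE unitfE.
pose v : 'rV[R]_k := (\row_j h (a + k + j)%N) *m invmx H.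
have sv : (size (rVpoly v) <= k)%N by exact: size_poly.
have sz : size ('X^k - rVpoly v) = k.+1.
  by rewrite size_polyDl ?size_polyXn // size_polyN ltnS.
exists ('X^k - rVpoly v); split=> //.
  by rewrite monicE lead_coefE sz coefB coefXn eqxx [(rVpoly v)`_k]nth_default ?subr0.
apply: hform_orthP => i lt_ik; rewrite -scaleN1r hformDl hformZl hformXn mulN1r.
apply/eqP; rewrite subr_eq0 eq_sym; apply/eqP; rewrite hformC (poly_sumXn sv) hform_sumr.
have /rowP/(_ (Ordinal lt_ik)) : v *m H = \row_j h (a + k + j)%N by rewrite mulmxKV.
rewrite !mxE => <-; apply: eq_bigr => j _.
by rewrite hformZr hformXn coef_rVpoly_ord [H _ _]mxE addnAC.
Qed.

Lemma hminorS (a k : nat) (q : {poly R}) :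
  q \is monic -> size q = k.+1 ->
  (forall s : {poly R}, (size s <= k)%N -> hform a q s = 0) ->
  hminor a k.+1 = hform a q q * hminor a k.
Proof.
move=> q_monic sq q_orth; pose Q i := if (i < k)%N then 'X^i else q.
rewrite -(@hminor_gram a k.+1 Q) => [|i lt_ik]; last first.
  rewrite /Q; case: ltnP => le_ki; first by rewrite monicXn size_polyXn.
  by have -> : i = k by [apply/eqP; rewrite eqn_leq le_ki -ltnS lt_ik].
rewrite fdet_last_row => [|j lt_jk]; last first.
  by rewrite /Q ltnn lt_jk q_orth // size_polyXn.
rewrite /Q ltnn; congr (_ * _); apply: eq_fdet => i j lt_ik lt_jk.
by rewrite lt_ik lt_jk hformXn.
Qed.

Lemma hpd_hminor_gt0 (a k : nat) : hpd a k -> 0 < hminor a k.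
Proof.
elim: k => [|k IHk] pd; first by rewrite /hminor fdet0.
have m_gt0 : 0 < hminor a k by apply: IHk => p /leqW; exact: pd.
have [q [q_monic sq q_orth]] := hminor_neq0 (lt0r_neq0 m_gt0).
rewrite (hminorS q_monic sq q_orth) mulr_gt0 // pd ?sq //.
exact: monic_neq0.
Qed.

(** On the line [s + t *: p] the form is affine in [t] with slope twice [hform a p s], so a nonzero
    slope would produce negative values. *)
Lemma hpsd_radical (a k : nat) (p : {poly R}) :
  hpsd a k -> (size p <= k)%N -> hform a p p = 0 ->
  forall s : {poly R}, (size s <= k)%N -> hform a p s = 0.
Proof.
move=> psd sp p0 s ss; apply/eqP/negPn/negP => ps0.
(* This [t] gives the form the value -1. *)
pose t := - (hform a s s + 1) / (hform a p s *+ 2).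
have : 0 <= hform a (s + t *: p) (s + t *: p).
  apply: psd; rewrite (leq_trans (size_polyD _ _)) // geq_max ss.
  by rewrite (leq_trans (size_scale_leq _ _)).
rewrite !(hformDl, hformDr, hformZl, hformZr) p0 (hformC a s p) !mulr0 addr0 -addrA.
have -> : t * hform a p s + t * hform a p s = - (hform a s s + 1).
  by rewrite /t; field; rewrite ps0.
lra.
Qed.

Lemma hpsd_pd (a k : nat) : hpsd a k -> hminor a k != 0 -> hpd a k.
Proof.
move=> psd d0 p sp p_neq0; rewrite lt_def psd // andbT; apply: contra d0 => /eqP p0.
apply/det0P; exists (poly_rV p : 'rV_k).
  apply: contra p_neq0 => /eqP v0; rewrite -(poly_rV_K sp) v0.
  by apply/eqP; rewrite linear0.
apply/rowP => i; rewrite !mxE.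
apply: etrans (hpsd_radical psd sp p0 (s := 'X^i) _); last by rewrite size_polyXn.
rewrite hformC [in RHS](poly_sumXn sp) hform_sumr; apply: eq_bigr => j _.
by rewrite hformZr hformXn !mxE addnAC.
Qed.


(** In the basis [1, ..., 'X^(m-1), p, 'X^(m+1)], the row and column of [p] vanish except against
    ['X^(m+1)]. Swapping the last two rows lets both entries be split off. *)
Lemma hminorSS (a m : nat) (p : {poly R}) :
  p \is monic -> size p = m.+1 ->
  (forall s : {poly R}, (size s <= m.+1)%N -> hform a p s = 0) ->
  hminor a m.+2 = - (hform a p 'X^(m.+1) ^+ 2 * hminor a m).
Proof.
move=> p_monic sp p_orth; pose Q i := if i == m then p else 'X^i.
have QX i : (i < m)%N -> Q i = 'X^i by rewrite /Q => lt_im; rewrite ltn_eqF.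
have Qm : Q m = p by rewrite /Q eqxx.
have QS : Q m.+1 = 'X^(m.+1) by rewrite /Q eqn_leq ltnn.
rewrite -(@hminor_gram a m.+2 Q) => [|i _]; last first.
  by rewrite /Q; case: eqP => [->|_]; rewrite ?monicXn ?size_polyXn.
have sQ i : size (Q i) = i.+1 by rewrite /Q; case: eqP => [->|]; rewrite ?size_polyXn.
have := fdet_swap_last m (fun i j => hform a (Q i) (Q j)).
move=> /(congr1 -%R); rewrite opprK => <-; congr (- _).
rewrite fdet_last_row => [|j lt_jm]; last first.
  by rewrite eqn_leq ltnn /= eqxx Qm p_orth // sQ.
rewrite fdet_last_col => [|i lt_im]; last first.
  by rewrite !(@ltn_eqF i) ?leqW // hformC Qm p_orth // sQ ltnW.
rewrite eqn_leq ltnn /= !eqxx Qm QS (hformC a 'X^(m.+1)) mulrA -expr2; congr (_ * _).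
apply: eq_fdet => i j lt_im lt_jm.
by rewrite !(@ltn_eqF i) ?leqW // !QX // hformXn.
Qed.

(** * Kernel elements of singular blocks *)

Lemma size_mulX_leq (p : {poly R}) (k : nat) : (size p <= k)%N -> (size ('X * p)%R <= k.+1)%N.
Proof. by move=> sp; rewrite (leq_trans (size_polyMleq _ _)) // size_polyX. Qed.

(** [hform a p ('X * p) = 0] says that [p] is isotropic at [a.+1]; semidefiniteness puts it in the
    radical there, which gains one test degree at [a]. *)
Lemma kernel_widen (a m : nat) (p : {poly R}) :
  hpsd a.+1 m.+1 -> (size p <= m)%N ->
  (forall s : {poly R}, (size s <= m.+1)%N -> hform a p s = 0) ->
  forall s : {poly R}, (size s <= m.+2)%N -> hform a p s = 0.
Proof.
move=> psd sp p_orth; apply: hform_orthP => -[|i] lt_im.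
  by rewrite p_orth // size_polyXn.
rewrite exprS hformMXr (hpsd_radical psd) ?size_polyXn //; first exact: leqW.
by rewrite -hformMXr p_orth // size_mulX_leq.
Qed.

(** The same argument two shifts up: [p] is isotropic at [a.+2], hence in the radical there. *)
Lemma kernel_mulX (a m : nat) (p : {poly R}) :
  hpsd a.+2 m.+1 -> (size p <= m)%N ->
  (forall s : {poly R}, (size s <= m.+2)%N -> hform a p s = 0) ->
  forall s : {poly R}, (size s <= m.+2)%N -> hform a ('X * p) s = 0.
Proof.
move=> psd sp p_orth; apply: hform_orthP => -[|i] lt_im; rewrite hformMXl.
  by rewrite -hformMXr p_orth // size_mulX_leq // size_polyXn.
rewrite exprS hformMXr (hpsd_radical psd) ?size_polyXn //; first exact: leqW.
by rewrite -!hformMXr p_orth // !size_mulX_leq.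
Qed.

Lemma kernel_exact_size (a m : nat) (p : {poly R}) :
  hpsd a.+2 m.+1 -> p != 0 -> (size p <= m.+1)%N ->
  (forall s : {poly R}, (size s <= m.+2)%N -> hform a p s = 0) ->
  exists q : {poly R}, size q = m.+1 /\
    forall s : {poly R}, (size s <= m.+2)%N -> hform a q s = 0.
Proof.
move=> psd; have [d] := ubnP (m.+1 - size p)%N; elim: d p => // d IHd p le_d p_neq0.
rewrite leq_eqVlt => /predU1P[sp|sp] p_orth; first by exists p.
have sXp : size ('X * p) = (size p).+1 by rewrite mulrC size_mulX.
apply: (IHd ('X * p)); rewrite ?sXp //; first lia.
  by rewrite mulf_neq0 ?polyX_eq0.
exact: kernel_mulX.
Qed.

(* Modulo the kernel element [q], whose shift ['X * q] completes the polynomials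
   of degree [<= m] to those of degree [<= m + 1], the form is the sum of its
   restriction to degree [<= m] and of the value [L(X^(a+2) q^2)]. *)
Lemma hpsd_of_kernel (a m : nat) (q : {poly R}) :
  hpsd a m.+1 -> hpsd a.+2 m.+1 -> size q = m.+1 ->
  (forall s : {poly R}, (size s <= m.+2)%N -> hform a q s = 0) ->
  hpsd a m.+2.
Proof.
move=> psd0 psd2 sq q_orth u su.
have q_neq0 : q != 0 by rewrite -size_poly_eq0 sq.
have sXq : size ('X * q) = m.+2 by rewrite mulrC size_mulX // sq.
pose t := u`_m.+1 / lead_coef q; pose s := u - t *: ('X * q).
have ss : (size s <= m.+1)%N.
  apply/leq_sizeP => j; rewrite leq_eqVlt => /predU1P[<-|lt_mj].
    rewrite coefB coefZ coefXM /= /t lead_coefE sq.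
    have : q`_m != 0 by move: q_neq0; rewrite -lead_coef_eq0 lead_coefE sq.
    by move=> qm; field.
  by rewrite nth_default // (leq_trans _ lt_mj) // (leq_trans (size_polyD _ _)) //
    geq_max su size_polyN (leq_trans (size_scale_leq _ _)) // sXq.
have -> : u = s + t *: ('X * q) by rewrite /s subrK.
clearbody s; rewrite !(hformDl, hformDr, hformZl, hformZr).
have sXq0 : hform a ('X * q) s = 0.
  by rewrite hformMXl -hformMXr q_orth // size_mulX_leq.
rewrite (hformC a s) sXq0 mulr0 addr0 add0r addr_ge0 ?psd0 //.
by rewrite mulrA -expr2 mulr_ge0 ?sqr_ge0 // hformMXl hformMXr psd2 // sq.
Qed.

(** * From nonnegative contiguous minors to semidefinite forms *)

Lemma hpsd_step (a k : nat) :
  hpsd a k -> hpsd a.+1 k -> hpsd a.+2 k ->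
  0 <= hminor a k.-1 -> 0 <= hminor a k -> 0 <= hminor a k.+1 ->
  hpsd a k.+1.
Proof.
move=> psd0 psd1 psd2 m_ge0 m0_ge0 mS_ge0.
have [m0_eq0|m0_neq0] := eqVneq (hminor a k) 0; last first.
  have [q [q_monic sq q_orth]] := hminor_neq0 m0_neq0.
  have qq_ge0 : 0 <= hform a q q.
    by move: mS_ge0; rewrite (hminorS q_monic sq q_orth) pmulr_lge0 // lt_def m0_neq0.
  move=> u su; pose t := u`_k; pose s := u - t *: q.
  have ss : (size s <= k)%N.
    apply/leq_sizeP => j; rewrite leq_eqVlt => /predU1P[<-|lt_kj].
      rewrite coefB coefZ; have := monicP q_monic; rewrite lead_coefE sq => ->.
      by rewrite mulr1 subrr.
    by rewrite nth_default // (leq_trans _ lt_kj) // (leq_trans (size_polyD _ _)) //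
      geq_max su size_polyN (leq_trans (size_scale_leq _ _)) // sq.
  have -> : u = s + t *: q by rewrite /s subrK.
  clearbody s; rewrite !(hformDl, hformDr, hformZl, hformZr).
  rewrite (hformC a s) q_orth // mulr0 addr0 add0r addr_ge0 ?psd0 //.
  by rewrite mulrA -expr2 mulr_ge0 ?sqr_ge0.
case: k => [|m] in psd0 psd1 psd2 m_ge0 m0_ge0 mS_ge0 m0_eq0 *.
  by move: m0_eq0; rewrite /hminor fdet0 => /eqP; rewrite oner_eq0.
rewrite /= in m_ge0.
(* A kernel element of the block of size [m.+2] of degree at most [m] suffices: it can be raised to
   degree exactly [m]. *)
suff [p [p_neq0 sp p_orth]] : exists p : {poly R}, [/\ p != 0, (size p <= m.+1)%N &
    forall s : {poly R}, (size s <= m.+2)%N -> hform a p s = 0].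
  have [q [sq q_orth]] := kernel_exact_size psd2 p_neq0 sp p_orth.
  exact: hpsd_of_kernel q_orth.
have small (p : {poly R}) : p != 0 -> (size p <= m)%N ->
    (forall s : {poly R}, (size s <= m.+1)%N -> hform a p s = 0) ->
    exists p : {poly R}, [/\ p != 0, (size p <= m.+1)%N &
      forall s : {poly R}, (size s <= m.+2)%N -> hform a p s = 0].
  move=> p_neq0 sp p_orth; exists p; split=> //; first exact: leqW.
  exact: kernel_widen.
have [p [p_neq0 sp p_orth]] := hminor_eq0 m0_eq0.
move: sp; rewrite leq_eqVlt => /predU1P[sp|sp]; last exact: small p_orth.
pose q := (lead_coef p)^-1 *: p.
have lc_neq0 : lead_coef p != 0 by rewrite lead_coef_eq0.
have sq : size q = m.+1 by rewrite size_scale ?invr_eq0.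
have q_monic : q \is monic by rewrite monicE lead_coefZ mulVf.
have q_orth (s : {poly R}) : (size s <= m.+1)%N -> hform a q s = 0.
  by move=> ss; rewrite hformZl p_orth ?mulr0.
have [c0|c_neq0] := eqVneq (hform a q 'X^(m.+1)) 0.
  exists q; split; rewrite ?monic_neq0 ?sq //.
  apply: hform_orthP => i; rewrite ltnS leq_eqVlt => /predU1P[->//|lt_im].
  by rewrite q_orth // size_polyXn.
(* With a nonzero pairing against ['X^(m+1)], [hminorSS] and [mS_ge0] force [hminor a m <= 0]. *)
have m_eq0 : hminor a m = 0.
  apply/eqP; rewrite eq_le m_ge0 andbT; move: mS_ge0.
  rewrite (hminorSS q_monic sq q_orth) oppr_ge0 pmulr_rle0 //.
  by rewrite lt_def sqrf_eq0 c_neq0 sqr_ge0.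
(* A kernel element of the block of size [m] is isotropic, so it lies in the radical for size [m.+1]
   and has degree below [m]. *)
have [p' [p'_neq0 sp' p'_orth]] := hminor_eq0 m_eq0.
apply: (small p') => //; apply: hpsd_radical => //; first exact: leqW.
exact: p'_orth.
Qed.

(** The bound fits the step: size [k.+1] at [a] allows size [k] at [a.+2], since
    [a.+2 + k.*2 = a + k.+1.*2]. *)
Lemma hminor_ge0_hpsd (r N : nat) :
  (forall a k, (k <= r)%N -> (a + k.*2 <= N)%N -> 0 <= hminor a k) ->
  forall a k, (k <= r)%N -> (a + k.*2 <= N)%N -> hpsd a k.
Proof.
move=> m_ge0 a k; elim: k a => [|k IHk] a le_kr le_aN.
  move=> p; rewrite leqn0 size_poly_eq0 => /eqP ->; by rewrite hform0r.
by apply: hpsd_step; first [apply: IHk; lia | apply: m_ge0; lia].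
Qed.

End HankelForm.

(** * Definite perturbation and arbitrary minors *)

Section PositiveHankelForms.
Variable R : realType.

Lemma hform_lin (h h' : nat -> R) (c : R) (a : nat) (p q : {poly R}) :
  hform (fun m => h m + c * h' m) a p q = hform h a p q + c * hform h' a p q.
Proof.
rewrite /hform /moment mulr_sumr -big_split; apply: eq_bigr => i _ /=; ring.
Qed.

(** The moments of the sum of unit masses at the points 1, ..., [n]. *)
Definition power_sum (n m : nat) : R := \sum_(t < n) t.+1%:R ^+ m.

Lemma moment_power_sum (n : nat) (p : {poly R}) :
  moment (power_sum n) p = \sum_(t < n) p.[t.+1%:R].
Proof.
rewrite /moment; under eq_bigr do rewrite mulr_sumr.
by rewrite exchange_big; apply: eq_bigr => t _; rewrite horner_coef.
Qed.

(** The form is a sum of terms [x ^+ a * p.[x] ^+ 2] over [n] positive points; if it vanished, [p]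
    would have [n] roots, more than its degree. *)
Lemma power_sum_hpd (n a k : nat) : (k <= n)%N -> hpd (power_sum n) a k.
Proof.
move=> le_kn p sp p_neq0; rewrite /hform moment_power_sum.
have term_ge0 (t : 'I_n) : 0 <= ('X^a * p * p).[t.+1%:R].
  by rewrite !hornerM hornerXn -mulrA -expr2 mulr_ge0 ?sqr_ge0 ?exprn_ge0.
rewrite lt_def sumr_ge0 // andbT; apply/negP => /eqP s0.
have /(max_poly_roots p_neq0) : all (root p) [seq t.+1%:R | t <- iota 0 n].
  apply/allP => _ /mapP[t lt_tn ->]; rewrite mem_iota add0n /= in lt_tn.
  have /eqP := psumr_eq0P (fun t _ => term_ge0 t) s0 (i := Ordinal lt_tn) isT.
  by rewrite !hornerM hornerXn !mulf_eq0 expf_eq0 pnatr_eq0 andbF /= orbb.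
rewrite map_inj_uniq ?iota_uniq => [/(_ isT)|t t' /eqP]; last first.
  by rewrite eqr_nat eqSS => /eqP.
by rewrite size_map size_iota ltnNge (leq_trans sp le_kn).
Qed.

Lemma hpd_fdet_gt0 (n r : nat) (h : nat -> R) :
  (forall a k, (k <= r)%N -> (a + k.*2 <= n.*2)%N -> hpd h a k) ->
  forall k f g, (k <= r)%N -> increasing_below n k f -> increasing_below n k g ->
  0 < fdet k (fun i j => h (f i + g j)%N).
Proof.
move=> pd; apply: (@fekete R n r (fun i j => h (i + j)%N)) => k b c le_kr le_bn le_cn.
rewrite (@eq_fdet _ _ _ (fun i j => h (b + c + i + j)%N)) => [|i j _ _].
  by apply/hpd_hminor_gt0/pd; lia.
by congr h; lia.
Qed.

Lemma horner0_ge0 (p : {poly R}) : (forall x, 0 < x -> 0 < p.[x]) -> 0 <= p.[0].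
Proof.
elim/poly_ind: p => [|q c _] p_gt0; first by rewrite horner0.
rewrite hornerMXaddC mulr0 add0r leNgt; apply/negP => c_lt0.
have [M M_bnd] := poly_disk_bound q 1.
have M_ge0 : 0 <= M by apply: le_trans (M_bnd 0 _); rewrite ?normr0.
have d_gt0 : 0 < M - c by lra.
(* Chosen so that [M * x + c = - c ^+ 2 / (M - c)], with [0 < x <= 1] so that the bound [M] on [q]
   applies. *)
pose x := - c / (M - c).
have x_gt0 : 0 < x by rewrite divr_gt0 ?oppr_gt0.
have x_le1 : x <= 1 by rewrite ler_pdivrMr //; lra.
have := p_gt0 x x_gt0; rewrite hornerMXaddC.
have : q.[x] * x <= M * x.
  by rewrite ler_pM2r // (le_trans (ler_norm _)) // M_bnd // gtr0_norm.
have : M * x + c <= 0; last by lra.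
have -> : M * x + c = - c ^+ 2 / (M - c) by rewrite /x; field; lra.
by rewrite mulNr oppr_le0 divr_ge0 ?sqr_ge0 // ltW.
Qed.

Lemma hpsd_fdet_ge0 (n r : nat) (h : nat -> R) :
  (forall a k, (k <= r)%N -> (a + k.*2 <= n.*2)%N -> hpsd h a k) ->
  forall k f g, (k <= r)%N -> increasing_below n k f -> increasing_below n k g ->
  0 <= fdet k (fun i j => h (f i + g j)%N).
Proof.
move=> psd k f g le_kr fP gP.
(* The minor of the perturbed sequence as a polynomial in the perturbation parameter: positive at
   every [x > 0], and the desired minor at 0. *)
pose P := fdet k (fun i j => (h (f i + g j)%N)%:P + 'X * (power_sum n (f i + g j)%N)%:P).
have PE x : P.[x] = fdet k (fun i j => h (f i + g j)%N + x * power_sum n (f i + g j)%N).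
  rewrite /P /fdet -horner_evalE -det_map_mx; congr (\det _).
  by apply/matrixP => i j; rewrite !mxE [LHS]horner_evalE !hornerE.
rewrite (_ : fdet _ _ = P.[0]); last first.
  by rewrite PE; apply: eq_fdet => i j _ _; rewrite mul0r addr0.
apply: horner0_ge0 => x x_gt0; rewrite PE.
apply: (@hpd_fdet_gt0 n r (fun m => h m + x * power_sum n m)) => // a l le_lr le_an p sp p0.
rewrite hform_lin; apply: ltr_wpDl; first exact: (psd a l).
by rewrite mulr_gt0 // (@power_sum_hpd n a l) //; lia.
Qed.

End PositiveHankelForms.

(** * From Hankel matrices to sequences *)

Section HankelMatrices.
Variables (R : realType) (n r : nat).

Lemma hankel_seq (A : 'M[R]_n) : (0 < n)%N -> hankel A ->
  exists h : nat -> R, forall i j : 'I_n, A i j = h (i + j)%N.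
Proof.
(* The antidiagonals are read down the first column, then along the last row. *)
case: n A => // m A _ hA; exists (fun l => A (inord (minn l m)) (inord (l - m))) => i j.
have := ltn_ord i; have := ltn_ord j => lt_j lt_i.
by apply: hA; rewrite !inordK; lia.
Qed.

(** The default 0 is never read: only arguments below [k] enter the determinants. *)
Definition ord_ext (k : nat) (f : 'I_k -> 'I_n) (i : nat) : nat :=
  if insub i is Some j then f j : nat else 0%N.

Lemma ord_extE (k : nat) (f : 'I_k -> 'I_n) (i : 'I_k) : ord_ext f i = f i.
Proof. by rewrite /ord_ext valK. Qed.

Lemma increasing_ord_ext (k : nat) (f : 'I_k -> 'I_n) :
  increasing f -> increasing_below n k (ord_ext f).
Proof.
move=> f_inc; split=> [i j /andP[lt_ij lt_jk]|i lt_ik].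
  have lt_ik := ltn_trans lt_ij lt_jk.
  rewrite -[i]/(val (Ordinal lt_ik)) -[j]/(val (Ordinal lt_jk)) !ord_extE.
  exact: f_inc.
by rewrite -[i]/(val (Ordinal lt_ik)) ord_extE.
Qed.

Lemma det_mxsub_hankel (A : 'M[R]_n) (h : nat -> R) (k : nat) (f g : 'I_k -> 'I_n) :
  (forall i j : 'I_n, A i j = h (i + j)%N) ->
  \det (mxsub f g A) = fdet k (fun i j => h (ord_ext f i + ord_ext g j)%N).
Proof.
move=> hE; rewrite /fdet; congr (\det _); apply/matrixP => i j.
by rewrite !mxE hE !ord_extE.
Qed.

(* The sums [f 0 + g 0] of starting points of contiguous blocks of size [k]
   range over all [a] with [a + 2 k <= 2 n]. *)
Lemma hminor_contiguous (A : 'M[R]_n) (h : nat -> R) (a k : nat) :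
  (forall i j : 'I_n, A i j = h (i + j)%N) -> (a + k.*2 <= n.*2)%N ->
  exists f g : 'I_k -> 'I_n,
    [/\ consecutive f, consecutive g & \det (mxsub f g A) = hminor h a k].
Proof.
move=> hE le_an; pose b := minn a (n - k).
have lt_b (i : 'I_k) : (b + i < n)%N by have := ltn_ord i; lia.
have lt_c (i : 'I_k) : (a - b + i < n)%N by have := ltn_ord i; lia.
exists (fun i => Ordinal (lt_b i)), (fun i => Ordinal (lt_c i)).
split; [by exists b | by exists (a - b)%N |].
rewrite /hminor /fdet; congr (\det _); apply/matrixP => i j.
by rewrite !mxE hE /=; congr h; lia.
Qed.

Lemma contiguous_ge0_hpsd (A : 'M[R]_n) (h : nat -> R) :
  (forall i j : 'I_n, A i j = h (i + j)%N) -> contiguous_minors_ge0 r A ->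
  forall a k, (k <= r)%N -> (a + k.*2 <= n.*2)%N -> hpsd h a k.
Proof.
move=> hE A_ge0; apply: hminor_ge0_hpsd => a k le_kr le_an.
have [f [g [fC gC <-]]] := hminor_contiguous hE le_an.
exact: A_ge0.
Qed.

Lemma contiguous_gt0_hpd (A : 'M[R]_n) (h : nat -> R) :
  (forall i j : 'I_n, A i j = h (i + j)%N) -> contiguous_minors_gt0 r A ->
  forall a k, (k <= r)%N -> (a + k.*2 <= n.*2)%N -> hpd h a k.
Proof.
move=> hE A_gt0 a k le_kr le_an; apply: hpsd_pd.
  apply: (contiguous_ge0_hpsd hE) => // l f g le_lr fC gC.
  exact/ltW/A_gt0.
have [f [g [fC gC <-]]] := hminor_contiguous hE le_an.
exact/lt0r_neq0/A_gt0.
Qed.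

End HankelMatrices.

Theorem theorem3p2 (R : realType) (n r : nat) (hn : (1 <= n)%N) (hr : (1 <= r)%N) :
  (forall A : 'M[R]_n, hankel A -> contiguous_minors_ge0 r A -> TN r A) /\
  (forall A B : 'M[R]_n,
     hankel A -> hankel B ->
     contiguous_minors_ge0 r A -> contiguous_minors_ge0 r B ->
     TN r (A + B)) /\
  (forall A B : 'M[R]_n,
     hankel A -> hankel B ->
     contiguous_minors_ge0 r A -> contiguous_minors_gt0 r B ->
     TP r (A + B)).
Proof.
(* The factor 1 puts the sum in the form of [hform_lin]. *)
have sumE (A B : 'M[R]_n) (h h' : nat -> R) :
    (forall i j : 'I_n, A i j = h (i + j)%N) ->
    (forall i j : 'I_n, B i j = h' (i + j)%N) ->
    forall i j : 'I_n, (A + B) i j = h (i + j)%N + 1 * h' (i + j)%N.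
  by move=> hE h'E i j; rewrite mxE hE h'E mul1r.
split=> [A hA A_ge0 k f g le_kr f_inc g_inc|].
  have [h hE] := hankel_seq hn hA; rewrite (det_mxsub_hankel _ _ hE).
  apply: hpsd_fdet_ge0 (le_kr) _ _; try exact: increasing_ord_ext.
  exact: contiguous_ge0_hpsd hE A_ge0.
split=> A B hA hB A_ge0 B_ge0 k f g le_kr f_inc g_inc.
all: have [h hE] := hankel_seq hn hA; have [h' h'E] := hankel_seq hn hB.
all: rewrite (det_mxsub_hankel (h := fun m => h m + 1 * h' m) f g (sumE _ _ _ _ hE h'E)).
- apply: (@hpsd_fdet_ge0 R n r (fun m => h m + 1 * h' m)) => //;
    try exact: increasing_ord_ext.
  move=> a l le_lr le_an p sp; rewrite hform_lin mul1r; apply: addr_ge0.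
    exact: (contiguous_ge0_hpsd hE A_ge0 le_lr le_an).
  exact: (contiguous_ge0_hpsd h'E B_ge0 le_lr le_an).
- apply: (@hpd_fdet_gt0 R n r (fun m => h m + 1 * h' m)) => //;
    try exact: increasing_ord_ext.
  move=> a l le_lr le_an p sp p_neq0; rewrite hform_lin mul1r; apply: ltr_wpDl.
    exact: (contiguous_ge0_hpsd hE A_ge0 le_lr le_an).
  exact: (contiguous_gt0_hpd h'E B_ge0 le_lr le_an).
Qed.
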